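(* For every Gödel set $V$, the set of sentences of the Bernays–Schönfinkel class (w.r.t. validity) that are valid in $G_V$ is decidable.
   Context: A Gödel set is a closed set $V\subseteq[0,1]$ with $0,1\in V$. A $V$-interpretation assigns to each $k$-ary predicate a function $U^k\to V$ on a nonempty domain $U$ (constants as usual); $\bot\mapsto0$, $\wedge,\vee$ are $\min,\max$, $\mathcal I(A\supset B)=1$ if $\mathcal I(A)\le\mathcal I(B)$ and $=\mathcal I(B)$ otherwise, $\forall,\exists$ are $\inf,\sup$ over $U$. A sentence is valid in $G_V$ if every $V$-interpretation gives it value $1$. The Bernays–Schönfinkel (BS) class w.r.t. validity consists of sentences $\forall\bar x\,\exists\bar y\,\psi(\bar x,\bar y)$ with $\psi$ quantifier-free, $\bar x,\bar y$ possibly empty tuples of variables, over a signature with no function symbols of positive arity (only constants and predicate symbols). *)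

(* Defs.v *)
From HB Require Import structures.
From mathcomp Require Import all_boot all_order all_algebra.
From mathcomp Require Import classical_sets reals topology normedtype.
Unset Printing Implicit Defensive.
Import Order.TTheory GRing.Theory Num.Theory numFieldNormedType.Exports.
Local Open Scope classical_set_scope.
Local Open Scope ring_scope.

(* Syntax of first-order formulas over a signature without function   *)
(* symbols of positive arity: variables x_n, constants c_n, predicate *)
(* symbols P_n (the arity of an atom is the length of its argument    *)
(* list; P_n applied to lists of different lengths are different      *)
(* predicate symbols).                                                *)
Inductive term : Type :=
| tVar (n : nat)
| tConst (n : nat).

Inductive form : Type :=
| fBot
| fAtom (p : nat) (ts : seq term)
| fAnd (a b : form)
| fOr (a b : form)
| fImp (a b : form)
| fAll (x : nat) (a : form)
| fEx (x : nat) (a : form).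

Definition term_free_in (x : nat) (t : term) : bool :=
  match t with tVar n => n == x | tConst _ => false end.

Fixpoint free_in (x : nat) (f : form) : bool :=
  match f with
  | fBot => false
  | fAtom _ ts => has (term_free_in x) ts
  | fAnd a b | fOr a b | fImp a b => free_in x a || free_in x b
  | fAll y a | fEx y a => (y != x) && free_in x a
  end.

Definition sentence (f : form) : Prop := forall x, free_in x f = false.

Fixpoint qfree (f : form) : bool :=
  match f with
  | fBot | fAtom _ _ => true
  | fAnd a b | fOr a b | fImp a b => qfree a && qfree b
  | fAll _ _ | fEx _ _ => false
  end.

Definition BS (f : form) : Prop :=
  exists (xs ys : seq nat) (psi : form),
    qfree psi /\
    f = foldr fAll (foldr fEx psi ys) xs /\
    sentence f.

Definition goedel_set (R : realType) (V : set R) : Prop :=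
  closed V /\ V `<=` [set x | 0 <= x <= 1] /\ V 0 /\ V 1.

Record interp (R : realType) (V : set R) := Interp {
  idom : Type;
  idom_pt : idom;
  iconst : nat -> idom;
  ipred : nat -> seq idom -> R;
  ipred_V : forall p l, V (ipred p l) }.

Definition upd (U : Type) (s : nat -> U) (x : nat) (u : U) : nat -> U :=
  fun y => if y == x then u else s y.

Definition teval (R : realType) (V : set R) (I : interp R V)
  (s : nat -> idom R V I) (t : term) : idom R V I :=
  match t with tVar n => s n | tConst n => iconst R V I n end.

Fixpoint feval (R : realType) (V : set R) (I : interp R V)
  (s : nat -> idom R V I) (f : form) {struct f} : R :=
  match f with
  | fBot => 0
  | fAtom p ts => ipred R V I p (map (teval R V I s) ts)
  | fAnd a b => Num.min (feval R V I s a) (feval R V I s b)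
  | fOr a b => Num.max (feval R V I s a) (feval R V I s b)
  | fImp a b => if feval R V I s a <= feval R V I s b then 1 else feval R V I s b
  | fAll x a => inf [set feval R V I (upd (idom R V I) s x u) a | u in [set: idom R V I]]
  | fEx x a => sup [set feval R V I (upd (idom R V I) s x u) a | u in [set: idom R V I]]
  end.

(* validity in G_V: value 1 under every V-interpretation (and every
   variable assignment; irrelevant for sentences) *)
Definition valid_GV (R : realType) (V : set R) (f : form) : Prop :=
  forall (I : interp R V) (s : nat -> idom R V I), feval R V I s f = 1.

Inductive rfun : Type :=
| rZero
| rSucc
| rProj (i : nat)
| rComp (f : rfun) (gs : seq rfun)
| rPrec (f g : rfun)
| rMu (f : rfun).

Inductive reval : rfun -> seq nat -> nat -> Prop :=
| ev_zero v : reval rZero v 0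
| ev_succ v : reval rSucc v (head 0%N v).+1
| ev_proj i v : reval (rProj i) v (nth 0%N v i)
| ev_comp f gs v ws r :
    revals gs v ws -> reval f ws r -> reval (rComp f gs) v r
| ev_prec0 f g v r : reval f v r -> reval (rPrec f g) (0%N :: v) r
| ev_precS f g n v r r' :
    reval (rPrec f g) (n :: v) r -> reval g (n :: r :: v) r' ->
    reval (rPrec f g) (n.+1 :: v) r'
| ev_mu f v n :
    reval f (n :: v) 0 ->
    (forall m, (m < n)%N -> exists k, (k != 0)%N /\ reval f (m :: v) k) ->
    reval (rMu f) v n
with revals : seq rfun -> seq nat -> seq nat -> Prop :=
| evs_nil v : revals [::] v [::]
| evs_cons g gs v w ws :
    reval g v w -> revals gs v ws -> revals (g :: gs) v (w :: ws).

(* Goedel numbering of formulas (Cantor pairing) *)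
Definition cpair (a b : nat) : nat := ((a + b) * (a + b).+1) %/ 2 + b.

Definition enc_term (t : term) : nat :=
  match t with tVar n => cpair 0 n | tConst n => cpair 1 n end.

Fixpoint enc_terms (ts : seq term) : nat :=
  match ts with
  | [::] => 0
  | t :: ts' => (cpair (enc_term t) (enc_terms ts')).+1
  end.

Fixpoint enc (f : form) : nat :=
  match f with
  | fBot => cpair 0 0
  | fAtom p ts => cpair 1 (cpair p (enc_terms ts))
  | fAnd a b => cpair 2 (cpair (enc a) (enc b))
  | fOr a b => cpair 3 (cpair (enc a) (enc b))
  | fImp a b => cpair 4 (cpair (enc a) (enc b))
  | fAll x a => cpair 5 (cpair x (enc a))
  | fEx x a => cpair 6 (cpair x (enc a))
  end.

Definition decidable_forms (P : form -> Prop) : Prop :=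
  exists p : rfun, forall f : form,
    (P f -> reval p [:: enc f] 1) /\ (~ P f -> reval p [:: enc f] 0).

(* Main.v *)
From HB Require Import structures.
Require Import Defs.
From mathcomp Require Import all_boot all_order all_algebra.
From mathcomp Require Import boolp classical_sets reals topology normedtype.
From mathcomp Require Import zify.

(* By Herbrand's theorem a prefix formula with quantifier-free matrix psi is valid iff, for every valuation of the ground atoms over the terms of psi and one more constant, some instance of psi gets value 1: supremum and infimum disappear because only finitely many instances matter. Such a propositional value depends only on the relative order of the finitely many ground atoms and of 0 and 1, so V may be replaced by a finite chain 0 < ... < K: if V has m elements take K = m - 1, and if V is infinite take K one more than the number of ground atoms. The test over that chain is a finite search.

To realize the search by a recursive function, formulas are processed through their codes: a fold over a formula is computed by listing its subformulas in preorder with a work list, and then reducing that list from the right with a stack. *)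

(* [all_algebra] has a sesquilinear [form] of its own. *)
Local Notation form := Defs.form.
Local Open Scope nat_scope.

(** * Recursive functions on natural numbers *)

Definition tri (n : nat) : nat := (n * n.+1) %/ 2.

Lemma triS n : tri n.+1 = n.+1 + tri n.
Proof. rewrite /tri; have -> : n.+1 * n.+2 = n.+1 * 2 + n * n.+1 by lia.
by rewrite divnMDl. Qed.

Lemma leq_tri : {homo tri : m n / m <= n}.
Proof.
move=> m n /subnK <-; elim: (n - m) => // k IH.
by rewrite addSn triS (leq_trans IH) // leq_addl.
Qed.

Lemma ex_croot n : exists w, n < tri w.+1.
Proof. by exists n; rewrite triS ltn_addr. Qed.

(** The index of the diagonal of the Cantor pairing on which [n] lies, that is, the sum of its two
    components. *)
Definition croot (n : nat) : nat := ex_minn (ex_croot n).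
Definition csnd (n : nat) : nat := n - tri (croot n).
Definition cfst (n : nat) : nat := croot n - csnd n.

Lemma cpairE a b : cpair a b = tri (a + b) + b. Proof. by []. Qed.

Lemma croot_cpair a b : croot (cpair a b) = a + b.
Proof.
rewrite /croot cpairE; case: ex_minnP => w lt_w min_w; apply/eqP.
rewrite eqn_leq min_w /=; last by rewrite triS; lia.
rewrite leqNgt; apply: contraL lt_w => /leq_tri le_w.
by rewrite -leqNgt (leq_trans le_w) ?leq_addr.
Qed.

Lemma cpairK2 a b : csnd (cpair a b) = b.
Proof. by rewrite /csnd croot_cpair cpairE addKn. Qed.

Lemma cpairK1 a b : cfst (cpair a b) = a.
Proof. by rewrite /cfst cpairK2 croot_cpair addnK. Qed.

Definition cpairK := (cpairK1, cpairK2).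

Lemma leq_cpair1 a b : a <= cpair a b.
Proof. rewrite cpairE; case: a => // a; rewrite addSn triS; lia. Qed.

Lemma leq_cpair2 a b : b <= cpair a b.
Proof. by rewrite cpairE leq_addl. Qed.

Lemma ltn_cpair2 a b : 0 < a -> b < cpair a b.
Proof. rewrite cpairE; case: a => // a _; rewrite addSn triS; lia. Qed.

(** * Programs for arithmetic and Cantor pairing *)

Lemma reval1 f g v w r :
  reval g v w -> reval f [:: w] r -> reval (rComp f [:: g]) v r.
Proof. move=> gw fr; apply: ev_comp fr; apply: evs_cons gw _; exact: evs_nil. Qed.

Lemma reval2 f g h v w z r :
  reval g v w -> reval h v z -> reval f [:: w; z] r ->
  reval (rComp f [:: g; h]) v r.
Proof.
move=> gw hz fr; apply: ev_comp fr; apply: evs_cons gw _.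
by apply: evs_cons hz _; exact: evs_nil.
Qed.

Definition rAdd := rPrec (rProj 0) (rComp rSucc [:: rProj 1]).
Definition rPred := rPrec rZero (rProj 0).
(** Subtraction with reversed arguments, because [rPrec] recurses on the first one: the subtrahend
    comes first. *)
Definition rSubr := rPrec (rProj 0) (rComp rPred [:: rProj 1]).
Definition rTri :=
  rPrec rZero (rComp rAdd [:: rComp rSucc [:: rProj 0]; rProj 1]).
Definition rPair :=
  rComp rAdd [:: rComp rTri [:: rAdd]; rProj 1].
(** Minimization looks for a zero: the truncated difference of [n.+1] and [tri w.+1] vanishes
    exactly when [n < tri w.+1]. *)
Definition rRoot :=
  rMu (rComp rSubr [:: rComp rTri [:: rComp rSucc [:: rProj 0]];
                       rComp rSucc [:: rProj 1]]).
Definition rSnd := rComp rSubr [:: rComp rTri [:: rRoot]; rProj 0].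
Definition rFst := rComp rSubr [:: rSnd; rRoot].

Lemma reval_proj i v r : nth 0 v i = r -> reval (rProj i) v r.
Proof. by move<-; exact: ev_proj. Qed.

Lemma reval_succ n v : reval rSucc (n :: v) n.+1.
Proof. exact: (ev_succ (n :: v)). Qed.

Lemma rAddP m n : reval rAdd [:: m; n] (m + n).
Proof.
elim: m => [|m IH]; first exact/ev_prec0/reval_proj.
apply: ev_precS IH _; apply: reval1 (reval_succ _ _); exact: reval_proj.
Qed.

Lemma rPredP n : reval rPred [:: n] n.-1.
Proof.
elim: n => [|n IH]; first exact/ev_prec0/ev_zero.
by apply: ev_precS IH _; exact: reval_proj.
Qed.

Lemma rSubrP m n : reval rSubr [:: m; n] (n - m).
Proof.
elim: m => [|m IH]; first by rewrite subn0; exact/ev_prec0/reval_proj.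
by apply: ev_precS IH _; rewrite subnS; apply: reval1 (rPredP _); exact: reval_proj.
Qed.

Lemma rTriP n : reval rTri [:: n] (tri n).
Proof.
elim: n => [|n IH]; first exact/ev_prec0/ev_zero.
apply: ev_precS IH _; rewrite triS; apply: reval2 (rAddP _ _); last exact: reval_proj.
by apply: reval1 (reval_succ _ _); exact: reval_proj.
Qed.

Lemma rPairP m n : reval rPair [:: m; n] (cpair m n).
Proof.
rewrite cpairE; apply: reval2 (rAddP _ _); last exact: reval_proj.
apply: ev_comp (rTriP _); apply: evs_cons (rAddP _ _) _; exact: evs_nil.
Qed.

Lemma rRootP n : reval rRoot [:: n] (croot n).
Proof.
have evw w : reval (rComp rSubr [:: rComp rTri [:: rComp rSucc [:: rProj 0]];
    rComp rSucc [:: rProj 1]]) [:: w; n] (n.+1 - tri w.+1).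
  apply: reval2 (rSubrP _ _); last by apply: reval1 (reval_succ _ _); exact: reval_proj.
  by apply: reval1 (rTriP _); apply: reval1 (reval_succ _ _); exact: reval_proj.
rewrite /croot; case: ex_minnP => w lt_w min_w; apply: ev_mu.
  by move: (evw w); rewrite (_ : n.+1 - tri w.+1 = 0) //; apply/eqP.
move=> m lt_m; exists (n.+1 - tri m.+1); split => //.
by rewrite subn_eq0; apply: contraL lt_m; rewrite -leqNgt; exact: min_w.
Qed.

Lemma rSndP n : reval rSnd [:: n] (csnd n).
Proof.
apply: reval2 (rSubrP _ _); last exact: reval_proj.
exact: reval1 (rRootP _) (rTriP _).
Qed.

Lemma rFstP n : reval rFst [:: n] (cfst n).
Proof. exact: reval2 (rSndP _) (rRootP _) (rSubrP _ _). Qed.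

(** Unary functions suffice, since several arguments are packed into one by [cpair]. *)
Definition rcomp (F : nat -> nat) : Prop :=
  exists p, forall n, reval p [:: n] (F n).

Lemma rcomp_id : rcomp id.
Proof. by exists (rProj 0) => n; exact: reval_proj. Qed.

Lemma rcomp_comp F G : rcomp F -> rcomp G -> rcomp (fun n => F (G n)).
Proof. by move=> [p pF] [q qG]; exists (rComp p [:: q]) => n; exact: reval1 (qG n) (pF _). Qed.

Lemma rcomp_succ F : rcomp F -> rcomp (fun n => (F n).+1).
Proof. by apply: (@rcomp_comp succn); exists rSucc => n; exact: reval_succ. Qed.

Lemma rcomp_const k : rcomp (fun=> k).
Proof. by elim: k => [|k /rcomp_succ //]; exists rZero => n; exact: ev_zero. Qed.

Lemma rcomp_pair F G : rcomp F -> rcomp G -> rcomp (fun n => cpair (F n) (G n)).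
Proof.
move=> [p pF] [q qG]; exists (rComp rPair [:: p; q]) => n.
exact: reval2 (pF n) (qG n) (rPairP _ _).
Qed.

Lemma rcomp_fst F : rcomp F -> rcomp (fun n => cfst (F n)).
Proof. by apply: (@rcomp_comp cfst); exists rFst; exact: rFstP. Qed.

Lemma rcomp_snd F : rcomp F -> rcomp (fun n => csnd (F n)).
Proof. by apply: (@rcomp_comp csnd); exists rSnd; exact: rSndP. Qed.

Lemma rcomp_rec N F G : rcomp N -> rcomp F -> rcomp G ->
  rcomp (fun a => nat_rect (fun=> nat) (F a) (fun n r => G (cpair a (cpair n r))) (N a)).
Proof.
move=> [p pN] [q qF] [g gG].
(* [rPrec] passes n, r, a to its step in this order; [h] repacks them as the nested pair that [G]
   expects. *)
pose h := rComp g [:: rComp rPair [:: rProj 2; rComp rPair [:: rProj 0; rProj 1]]].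
exists (rComp (rPrec q h) [:: p; rProj 0]) => a.
apply: (reval2 _ _ _ [:: a] (N a) a _ (pN a)); first exact: reval_proj.
elim: (N a) => [|n IH] /=; first exact: ev_prec0.
apply: ev_precS IH _; apply: reval1 (gG _); apply: reval2 (rPairP _ _).
  exact: reval_proj.
by apply: reval2 (rPairP _ _); exact: reval_proj.
Qed.

(** * Computable functions on coded data *)

Class Coded (A : Type) := code : A -> nat.
Instance nat_coded : Coded nat := id.
Instance bool_coded : Coded bool := nat_of_bool.
Instance prod_coded A B `{Coded A, Coded B} : Coded (A * B) :=
  fun x => cpair (code x.1) (code x.2).
(** The same scheme as [enc_terms], so the arguments of an atom are already coded as a list of
    terms. *)
Instance seq_coded A `{Coded A} : Coded (seq A) :=
  foldr (fun x n => (cpair (code x) n).+1) 0.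
Instance term_coded : Coded term := enc_term.
Instance form_coded : Coded form := enc.

(* The realizer is total even off the range of [code]: a primitive recursion evaluates its step at every smaller number, whether or not it is a code. *)
Definition cmp {A B} `{Coded A, Coded B} (f : A -> B) : Prop :=
  exists2 F, rcomp F & forall a, F (code a) = code (f a).

Lemma cmp_eq {A B} `{Coded A, Coded B} (f g : A -> B) : f =1 g -> cmp f -> cmp g.
Proof. by move=> fg [F cF Ff]; exists F => // a; rewrite Ff fg. Qed.

(** Allows a destructor to be programmed as arithmetic on codes. *)
Lemma cmp_lift {A B} `{Coded A, Coded B} (F : nat -> nat) (f : A -> B) :
  cmp F -> (forall a, F (code a) = code (f a)) -> cmp f.
Proof. by move=> [G cG GF] Ff; exists G => // a; rewrite [LHS]GF Ff. Qed.

Section Combinators.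
Context {A B C : Type} `{Coded A, Coded B, Coded C}.

Lemma cmp_id : cmp (fun a : A => a).
Proof. by exists id => //; exact: rcomp_id. Qed.

Lemma cmp_comp (f : B -> C) (g : A -> B) : cmp f -> cmp g -> cmp (fun a => f (g a)).
Proof.
move=> [F cF Ff] [G cG Gg]; exists (fun n => F (G n)); first exact: rcomp_comp.
by move=> a; rewrite Gg Ff.
Qed.

Lemma cmp_const (b : B) : cmp (fun _ : A => b).
Proof. by exists (fun=> code b) => //; exact: rcomp_const. Qed.

Lemma cmp_code (f : A -> B) : cmp f -> cmp (fun a => code (f a)).
Proof. by move=> [F cF Ff]; exists F. Qed.

Lemma cmp_pair (f : A -> B) (g : A -> C) : cmp f -> cmp g -> cmp (fun a => (f a, g a)).
Proof.
move=> [F cF Ff] [G cG Gg]; exists (fun n => cpair (F n) (G n)); first exact: rcomp_pair.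
by move=> a; rewrite Ff Gg.
Qed.

Lemma cmp_fst (f : A -> B * C) : cmp f -> cmp (fun a => (f a).1).
Proof.
move=> [F cF Ff]; exists (fun n => cfst (F n)); first exact: rcomp_fst.
by move=> a; rewrite Ff cpairK1.
Qed.

Lemma cmp_snd (f : A -> B * C) : cmp f -> cmp (fun a => (f a).2).
Proof.
move=> [F cF Ff]; exists (fun n => csnd (F n)); first exact: rcomp_snd.
by move=> a; rewrite Ff cpairK2.
Qed.

Lemma cmp_cpair (f g : A -> nat) : cmp f -> cmp g -> cmp (fun a => cpair (f a) (g a)).
Proof.
move=> [F cF Ff] [G cG Gg]; exists (fun n => cpair (F n) (G n)); first exact: rcomp_pair.
by move=> a; rewrite Ff Gg.
Qed.

Lemma cmp_cfst (f : A -> nat) : cmp f -> cmp (fun a => cfst (f a)).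
Proof.
move=> [F cF Ff]; exists (fun n => cfst (F n)); first exact: rcomp_fst.
by move=> a; rewrite Ff.
Qed.

Lemma cmp_csnd (f : A -> nat) : cmp f -> cmp (fun a => csnd (f a)).
Proof.
move=> [F cF Ff]; exists (fun n => csnd (F n)); first exact: rcomp_snd.
by move=> a; rewrite Ff.
Qed.

Lemma cmp_succ (f : A -> nat) : cmp f -> cmp (fun a => (f a).+1).
Proof.
move=> [F cF Ff]; exists (fun n => (F n).+1); first exact: rcomp_succ.
by move=> a; rewrite Ff.
Qed.

Lemma cmp_rec (N : A -> nat) (f : A -> B) (g : A * (nat * B) -> B) :
  cmp N -> cmp f -> cmp g ->
  cmp (fun a => nat_rect (fun=> B) (f a) (fun n r => g (a, (n, r))) (N a)).
Proof.
move=> [M cM MN] [F cF Ff] [G cG Gg].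
exists (fun a => nat_rect (fun=> nat) (F a) (fun n r => G (cpair a (cpair n r))) (M a)).
  exact: rcomp_rec.
move=> a; rewrite MN [code (N a)]/code /nat_coded; elim: (N a) => [|n IH] /=.
  exact: Ff.
by rewrite IH -Gg.
Qed.

End Combinators.

Section Branching.
Context {A B : Type} `{Coded A, Coded B}.

Lemma cmp_iter (N : A -> nat) (h : A * B -> B) (z : A -> B) :
  cmp N -> cmp h -> cmp z -> cmp (fun a => iter (N a) (fun b => h (a, b)) (z a)).
Proof.
move=> cN ch cz.
apply: (@cmp_eq _ _ _ _ (fun a => nat_rect (fun=> B) (z a) (fun n r => h (a, r)) (N a))).
  by move=> a; elim: (N a) => //= n ->.
apply: (cmp_rec N z (fun x => h (x.1, x.2.2))) => //.
apply: (cmp_comp h); first by [].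
by apply: cmp_pair; [exact/cmp_fst/cmp_id | exact/cmp_snd/cmp_snd/cmp_id].
Qed.

Lemma cmp_natcase (N : A -> nat) (f : A -> B) (g : A * nat -> B) :
  cmp N -> cmp f -> cmp g ->
  cmp (fun a => if N a is n.+1 then g (a, n) else f a).
Proof.
move=> cN cf cg.
apply: (@cmp_eq _ _ _ _ (fun a => nat_rect (fun=> B) (f a) (fun n r => g (a, n)) (N a))).
  by move=> a; case: (N a).
apply: (cmp_rec N f (fun x => g (x.1, x.2.1))) => //.
apply: (cmp_comp g); first by [].
by apply: cmp_pair; [exact/cmp_fst/cmp_id | exact/cmp_fst/cmp_snd/cmp_id].
Qed.

Lemma cmp_if (b : A -> bool) (f g : A -> B) :
  cmp b -> cmp f -> cmp g -> cmp (fun a => if b a then f a else g a).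
Proof.
move=> cb cf cg.
apply: (@cmp_eq _ _ _ _ (fun a => if code (b a) is n.+1 then f a else g a)).
  by move=> a; case: (b a).
apply: (cmp_natcase _ g (fun x => f x.1)); [exact: cmp_code | by [] |].
by apply: (cmp_comp f) => //; exact/cmp_fst/cmp_id.
Qed.

End Branching.

Section SeqCase.
Context {A B C : Type} `{Coded A, Coded B, Coded C}.

Lemma cmp_cons (f : A -> B) (l : A -> seq B) :
  cmp f -> cmp l -> cmp (fun a => f a :: l a).
Proof.
move=> [F cF Ff] [G cG Gg]; exists (fun n => (cpair (F n) (G n)).+1).
  exact/rcomp_succ/rcomp_pair.
by move=> a; rewrite Ff Gg.
Qed.

Lemma cmp_seqcase (l : A -> seq B) (f : A -> C) (g : A * (B * seq B) -> C) :
  cmp l -> cmp f -> cmp g ->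
  cmp (fun a => if l a is x :: t then g (a, (x, t)) else f a).
Proof.
move=> [L cL Ll] [F cF Ff] [G cG Gg].
(* The code of a nonempty list is the successor of the code of the pair of its head and tail, so the
   case distinction on lists is one on numbers. *)
have cM : cmp (fun n : nat => if L n is m.+1 then G (cpair n m) else F n).
  apply: (cmp_natcase L F (fun x => G (cpair x.1 x.2))); [by exists L | by exists F |].
  by apply: (cmp_comp G); [by exists G | apply: cmp_cpair; [exact/cmp_fst/cmp_id | exact/cmp_snd/cmp_id]].
apply: (cmp_lift _ _ cM) => a; rewrite Ll; case: (l a) => [|x t] /=; first exact: Ff.
exact: (Gg (a, (x, t))).
Qed.

End SeqCase.

Section Fold.
Context {A B C : Type} `{Coded A, Coded B, Coded C}.

(** The code of a list serves as fuel for a loop over it. *)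
Lemma size_code (l : seq B) : size l <= code l.
Proof. by elim: l => //= x l IH; rewrite ltnS (leq_trans IH) ?leq_cpair2. Qed.

Lemma cmp_foldl (h : A * (C * B) -> C) (z : A -> C) (l : A -> seq B) :
  cmp h -> cmp z -> cmp l ->
  cmp (fun a => foldl (fun c b => h (a, (c, b))) (z a) (l a)).
Proof.
move=> ch cz cl.
pose st a (x : seq B * C) := if x.1 is b :: t then (t, h (a, (x.2, b))) else x.
have E a n l' c : size l' <= n -> (iter n (st a) (l', c)).2 =
    foldl (fun c b => h (a, (c, b))) c l'.
  elim: n l' c => [|n IH] [|b l'] c // le_n; rewrite iterSr /st /=; last exact: IH.
  exact: IH.
apply: (@cmp_eq _ _ _ _ (fun a => (iter (code (l a)) (st a) (l a, z a)).2)).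
  by move=> a; rewrite E // size_code.
apply: cmp_snd; apply: (cmp_iter _ (fun x => st x.1 x.2)).
- exact: cmp_code.
- rewrite /st; apply: (cmp_seqcase (fun x : A * (seq B * C) => x.2.1) (fun x => x.2)
    (fun x => (x.2.2, h (x.1.1, (x.1.2.2, x.2.1))))).
  + exact/cmp_fst/cmp_snd/cmp_id.
  + exact/cmp_snd/cmp_id.
  + apply: cmp_pair; first exact/cmp_snd/cmp_snd/cmp_id.
    apply: (cmp_comp h) => //; apply: cmp_pair; first exact/cmp_fst/cmp_fst/cmp_id.
    by apply: cmp_pair; [exact/cmp_snd/cmp_snd/cmp_fst/cmp_id | exact/cmp_fst/cmp_snd/cmp_id].
- exact: cmp_pair.
Qed.

End Fold.

Section Lists.
Context {A B C : Type} `{Coded A, Coded B, Coded C}.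

Lemma cmp_rev (l : A -> seq B) : cmp l -> cmp (fun a => rev (l a)).
Proof.
move=> cl.
apply: (@cmp_eq _ _ _ _ (fun a => foldl (fun c b => b :: c) [::] (l a))).
  by move=> a; rewrite -[X in foldl _ _ X]revK foldl_rev; elim: (rev _) => //= x t ->.
apply: (cmp_foldl (fun x : A * (seq B * B) => x.2.2 :: x.2.1)) => //; last exact: cmp_const.
apply: cmp_cons; [exact/cmp_snd/cmp_snd/cmp_id | exact/cmp_fst/cmp_snd/cmp_id].
Qed.

End Lists.

Section ListFunctions.
Context {A B C : Type} `{Coded A, Coded B, Coded C}.

Lemma cmp_foldr (h : A -> B -> C -> C) (z : A -> C) (l : A -> seq B) :
  cmp (fun x : A * (B * C) => h x.1 x.2.1 x.2.2) -> cmp z -> cmp l ->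
  cmp (fun a => foldr (h a) (z a) (l a)).
Proof.
move=> ch cz cl.
apply: (@cmp_eq _ _ _ _ (fun a => foldl (fun c b => h a b c) (z a) (rev (l a)))).
  by move=> a; rewrite foldl_rev.
apply: (cmp_foldl (fun x : A * (C * B) => h x.1 x.2.2 x.2.1)) => //; last exact: cmp_rev.
apply: (cmp_comp (fun x : A * (B * C) => h x.1 x.2.1 x.2.2)
  (fun x : A * (C * B) => (x.1, (x.2.2, x.2.1)))) => //.
apply: cmp_pair; first exact/cmp_fst/cmp_id.
by apply: cmp_pair; [exact/cmp_snd/cmp_snd/cmp_id | exact/cmp_fst/cmp_snd/cmp_id].
Qed.

Lemma cmp_cat (l m : A -> seq B) : cmp l -> cmp m -> cmp (fun a => l a ++ m a).
Proof.
move=> cl cm.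
apply: (@cmp_eq _ _ _ _ (fun a => foldl (fun c b => b :: c) (m a) (rev (l a)))).
  by move=> a; rewrite foldl_rev; elim: (l a) => //= x t ->.
apply: (cmp_foldl (fun x : A * (seq B * B) => x.2.2 :: x.2.1)) => //; last exact: cmp_rev.
by apply: cmp_cons; [exact/cmp_snd/cmp_snd/cmp_id | exact/cmp_fst/cmp_snd/cmp_id].
Qed.

Lemma cmp_pred (f : A -> nat) : cmp f -> cmp (fun a => (f a).-1).
Proof.
move=> cf; apply: (@cmp_eq _ _ _ _ (fun a => if f a is n.+1 then (a, n).2 else 0)).
  by move=> a; case: (f a).
by apply: (cmp_natcase f _ (fun x => x.2)); [|exact: cmp_const|exact/cmp_snd/cmp_id].
Qed.

End ListFunctions.

Section ListFunctions2.
Context {A B C : Type} `{Coded A, Coded B, Coded C}.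

Lemma cmp_map (h : A -> B -> C) (l : A -> seq B) :
  cmp (fun x : A * B => h x.1 x.2) -> cmp l -> cmp (fun a => map (h a) (l a)).
Proof.
move=> ch cl; apply: (cmp_foldr (fun a b c => h a b :: c) (fun=> [::])) => //; last exact: cmp_const.
apply: cmp_cons; last exact/cmp_snd/cmp_snd/cmp_id.
apply: (cmp_comp (fun x : A * B => h x.1 x.2) (fun x : A * (B * seq C) => (x.1, x.2.1))) => //.
by apply: cmp_pair; [exact/cmp_fst/cmp_id | exact/cmp_fst/cmp_snd/cmp_id].
Qed.

Lemma cmp_flatten (l : A -> seq (seq B)) : cmp l -> cmp (fun a => flatten (l a)).
Proof.
move=> cl; apply: (cmp_foldr (fun _ => cat)) => //; last exact: cmp_const.
by apply: cmp_cat; [exact/cmp_fst/cmp_snd/cmp_id | exact/cmp_snd/cmp_snd/cmp_id].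
Qed.

Lemma cmp_size (l : A -> seq B) : cmp l -> cmp (fun a => size (l a)).
Proof.
move=> cl; apply: (@cmp_eq _ _ _ _ (fun a => foldr (fun _ n => n.+1) 0 (l a))) => //.
apply: (cmp_foldr (fun _ _ => succn) (fun=> 0)) => //; last exact: cmp_const.
exact/cmp_succ/cmp_snd/cmp_snd/cmp_id.
Qed.

Lemma cmp_has (h : A -> B -> bool) (l : A -> seq B) :
  cmp (fun x : A * B => h x.1 x.2) -> cmp l -> cmp (fun a => has (h a) (l a)).
Proof.
move=> ch cl; apply: (cmp_foldr (fun a b c => if h a b then true else c) (fun=> false)) => //; last exact: cmp_const.
apply: cmp_if; [|exact: cmp_const|exact/cmp_snd/cmp_snd/cmp_id].
apply: (cmp_comp (fun x : A * B => h x.1 x.2) (fun x : A * (B * bool) => (x.1, x.2.1))) => //.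
by apply: cmp_pair; [exact/cmp_fst/cmp_id | exact/cmp_fst/cmp_snd/cmp_id].
Qed.

Lemma cmp_all (h : A -> B -> bool) (l : A -> seq B) :
  cmp (fun x : A * B => h x.1 x.2) -> cmp l -> cmp (fun a => all (h a) (l a)).
Proof.
move=> ch cl; apply: (cmp_foldr (fun a b c => if h a b then c else false) (fun=> true)) => //; last exact: cmp_const.
apply: cmp_if; [|exact/cmp_snd/cmp_snd/cmp_id|exact: cmp_const].
apply: (cmp_comp (fun x : A * B => h x.1 x.2) (fun x : A * (B * bool) => (x.1, x.2.1))) => //.
by apply: cmp_pair; [exact/cmp_fst/cmp_id | exact/cmp_fst/cmp_snd/cmp_id].
Qed.

Lemma cmp_and (b c : A -> bool) : cmp b -> cmp c -> cmp (fun a => b a && c a).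
Proof. by move=> cb cc; apply: cmp_if => //; exact: cmp_const. Qed.

Lemma cmp_or (b c : A -> bool) : cmp b -> cmp c -> cmp (fun a => b a || c a).
Proof. by move=> cb cc; apply: cmp_if => //; exact: cmp_const. Qed.

Lemma cmp_sub (f g : A -> nat) : cmp f -> cmp g -> cmp (fun a => f a - g a).
Proof.
move=> cf cg; apply: (@cmp_eq _ _ _ _ (fun a => iter (g a) predn (f a))).
  by move=> a; elim: (g a) => [|n IH]; rewrite ?subn0 // iterS IH subnS.
apply: (cmp_iter g (fun x : A * nat => x.2.-1)) => //.
exact/cmp_pred/cmp_snd/cmp_id.
Qed.

Lemma cmp_leq (f g : A -> nat) : cmp f -> cmp g -> cmp (fun a => f a <= g a).
Proof.
move=> cf cg; apply: (@cmp_eq _ _ _ _ (fun a => if f a - g a is n.+1 then false else true)).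
  by move=> a; rewrite /leq; case: (f a - g a).
apply: (cmp_natcase (fun a => f a - g a) (fun=> true) (fun=> false)).
- exact: cmp_sub.
- exact: cmp_const.
- exact: cmp_const.
Qed.

Lemma cmp_eqn (f g : A -> nat) : cmp f -> cmp g -> cmp (fun a => f a == g a).
Proof.
move=> cf cg; apply: (@cmp_eq _ _ _ _ (fun a => (f a <= g a) && (g a <= f a))).
  by move=> a; rewrite eqn_leq.
by apply: cmp_and; exact: cmp_leq.
Qed.

Lemma cmp_minn (f g : A -> nat) : cmp f -> cmp g -> cmp (fun a => minn (f a) (g a)).
Proof. by move=> cf cg; apply: cmp_if => //; apply: cmp_leq => //; exact: cmp_succ. Qed.

Lemma cmp_maxn (f g : A -> nat) : cmp f -> cmp g -> cmp (fun a => maxn (f a) (g a)).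
Proof. by move=> cf cg; apply: cmp_if => //; apply: cmp_leq => //; exact: cmp_succ. Qed.

Lemma cmp_iota (f : A -> nat) : cmp f -> cmp (fun a => iota 0 (f a)).
Proof.
move=> cf.
apply: (@cmp_eq _ _ _ _
  (fun a => nat_rect (fun=> seq nat) [::] (fun n r => r ++ [:: n]) (f a))).
  by move=> a; elim: (f a) => // n IH; rewrite -addn1 iotaD -IH addn1.
apply: (cmp_rec f _ (fun x : A * (nat * seq nat) => x.2.2 ++ [:: x.2.1])) => //.
  exact: cmp_const.
apply: cmp_cat; first exact/cmp_snd/cmp_snd/cmp_id.
by apply: cmp_cons; [exact/cmp_fst/cmp_snd/cmp_id | exact: cmp_const].
Qed.

End ListFunctions2.

(** * Equality of coded data *)

Lemma cpair_inj a b c d : cpair a b = cpair c d -> a = c /\ b = d.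
Proof.
move=> E; split; first by rewrite -[LHS](cpairK1 a b) E cpairK1.
by rewrite -[LHS](cpairK2 a b) E cpairK2.
Qed.

Lemma code_term_inj : injective (@code term _).
Proof.
move=> [n|n] [m|m] E; have [E1 E2] := cpair_inj _ _ _ _ E; rewrite ?E2 //.
Qed.

Lemma code_seq_inj A `{Coded A} : injective (@code A _) -> injective (@code (seq A) _).
Proof.
move=> injA; elim=> [|x s IH] [|y t] //= [] /cpair_inj[/injA -> E].
by rewrite (IH t E).
Qed.

Lemma code_pair_inj A B `{Coded A, Coded B} :
  injective (@code A _) -> injective (@code B _) -> injective (@code (A * B)%type _).
Proof. by move=> iA iB [a b] [c d] /cpair_inj[/iA /= -> /iB /= ->]. Qed.

HB.instance Definition _ := Equality.copy term (inj_type code_term_inj).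

Definition atom : Type := nat * seq term.
HB.instance Definition _ := Equality.on atom.
Instance atom_coded : Coded atom := prod_coded nat (seq term).

Lemma code_atom_inj : injective (@code atom _).
Proof. by apply: code_pair_inj => //; exact/code_seq_inj/code_term_inj. Qed.

Lemma cmp_eqop {A} {K : eqType} `{Coded A, Coded K} (f g : A -> K) :
  injective (@code K _) -> cmp f -> cmp g -> cmp (fun a => f a == g a).
Proof.
move=> iK cf cg; apply: (@cmp_eq _ _ _ _ (fun a => code (f a) == code (g a))).
  by move=> a; rewrite inj_eq.
by apply: cmp_eqn; exact: cmp_code.
Qed.

Lemma cmp_in {A} {K : eqType} `{Coded A, Coded K} (f : A -> K) (l : A -> seq K) :
  injective (@code K _) -> cmp f -> cmp l -> cmp (fun a => f a \in l a).
Proof.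
move=> iK cf cl; apply: (@cmp_eq _ _ _ _ (fun a => has (fun x => x == f a) (l a))).
  by move=> a; rewrite has_pred1.
apply: (cmp_has (fun a x => x == f a)) => //; apply: cmp_eqop => //.
  exact/cmp_snd/cmp_id.
by apply: (cmp_comp f) => //; exact/cmp_fst/cmp_id.
Qed.

(** Follows the head symbol of the function; the patterns [@?f a] recover its arguments as functions
    of the input. Under [repeat] it stops at symbols that are not listed, which are then treated by
    hand. *)
Ltac cmp_step :=
  lazymatch goal with
  | |- cmp (fun x => x) => exact: cmp_id
  | |- cmp (fun _ => ?b) => exact: cmp_const
  | |- cmp fst => exact: (cmp_fst (fun x => x) cmp_id)
  | |- cmp snd => exact: (cmp_snd (fun x => x) cmp_id)
  | |- cmp (fun a => (@?f a).1) => apply: (cmp_fst f)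
  | |- cmp (fun a => (@?f a).2) => apply: (cmp_snd f)
  | |- cmp (fun a => (@?f a, @?g a)) => apply: (cmp_pair f g)
  | |- cmp (fun a => @?f a :: @?g a) => apply: (cmp_cons f g)
  | |- cmp (fun a => @?f a ++ @?g a) => apply: (cmp_cat f g)
  | |- cmp (fun a => cpair (@?f a) (@?g a)) => apply: (cmp_cpair f g)
  | |- cmp (fun a => cfst (@?f a)) => apply: (cmp_cfst f)
  | |- cmp (fun a => csnd (@?f a)) => apply: (cmp_csnd f)
  | |- cmp (fun a => (@?f a).+1) => apply: (cmp_succ f)
  | |- cmp (fun a => @?f a <= @?g a) => apply: (cmp_leq f g)
  | |- cmp (fun a => @eq_op _ (@?f a) (@?g a)) => apply: (cmp_eqop f g)
  | |- cmp (fun a => @?f a && @?g a) => apply: (cmp_and f g)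
  | |- cmp (fun a => @?f a || @?g a) => apply: (cmp_or f g)
  | |- cmp (fun a => minn (@?f a) (@?g a)) => apply: (cmp_minn f g)
  | |- cmp (fun a => maxn (@?f a) (@?g a)) => apply: (cmp_maxn f g)
  | |- cmp (fun a => size (@?f a)) => apply: (cmp_size f)
  | |- cmp (fun a => flatten (@?f a)) => apply: (cmp_flatten f)
  | |- cmp (fun a => iota 0 (@?f a)) => apply: (cmp_iota f)
  | |- cmp (fun a => has (@?h a) (@?l a)) => apply: (cmp_has h l)
  | |- cmp (fun a => all (@?h a) (@?l a)) => apply: (cmp_all h l)
  | |- cmp (fun a => map (@?h a) (@?l a)) => apply: (cmp_map h l)
  | |- cmp (fun a => foldr (@?h a) (@?z a) (@?l a)) => apply: (cmp_foldr h z l)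
  | |- cmp (fun a => @?f a \in @?l a) => apply: (cmp_in f l)
  | |- cmp (fun a => if _ then _ else _) => apply: cmp_if
  | |- injective _ => first [assumption | by move=> ? ?]
  | _ => assumption
  end.

(** * Association lists as finite functions *)

Definition lookup {K : eqType} {B : Type} (d : B) (e : seq (K * B)) (k : K) : B :=
  foldr (fun x r => if x.1 == k then x.2 else r) d e.

(** Enumerates the maps from [ks] to [vs]; used both for substitutions and for valuations of ground
    atoms. A repeated key may receive several values, of which [lookup] sees the first. *)
Definition alists {K B : Type} (ks : seq K) (vs : seq B) : seq (seq (K * B)) :=
  foldr (fun k es => [seq (k, v) :: e | v <- vs, e <- es]) [:: [::]] ks.

Lemma cmp_lookup {A} {K : eqType} {B} `{Coded A, Coded K, Coded B}
    (d : A -> B) (e : A -> seq (K * B)) (k : A -> K) :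
  injective (@code K _) -> cmp d -> cmp e -> cmp k ->
  cmp (fun a => lookup (d a) (e a) (k a)).
Proof.
move=> iK cd ce ck.
apply: (cmp_foldr (fun a x r => if x.1 == k a then x.2 else r)) => //.
repeat cmp_step.
by apply: (cmp_comp k); repeat cmp_step.
Qed.

Lemma cmp_alists {A K B} `{Coded A, Coded K, Coded B} (ks : A -> seq K) (vs : A -> seq B) :
  cmp ks -> cmp vs -> cmp (fun a => alists (ks a) (vs a)).
Proof.
move=> cks cvs.
apply: (cmp_foldr (fun a k es => [seq (k, v) :: e | v <- vs a, e <- es])) => //; last exact: cmp_const.
apply: cmp_flatten; apply: cmp_map; last by apply: (cmp_comp vs); repeat cmp_step.
by repeat cmp_step.
Qed.

Section AssociationLists.
Context {K B : eqType}.
Implicit Types (ks : seq K) (vs : seq B) (e : seq (K * B)).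

Lemma lookup_map d (g : K -> B) ks k :
  lookup d [seq (x, g x) | x <- ks] k = if k \in ks then g k else d.
Proof.
elim: ks => //= x ks IH; rewrite in_cons eq_sym.
by case: eqP => //= <-.
Qed.

Lemma map_in_alists (g : K -> B) ks vs :
  (forall k, k \in ks -> g k \in vs) -> [seq (x, g x) | x <- ks] \in alists ks vs.
Proof.
elim: ks => //= k ks IH kv; apply/allpairsP => /=.
exists (g k, [seq (x, g x) | x <- ks]); split => //=.
  by apply: kv; rewrite mem_head.
by apply: IH => x xs; apply: kv; rewrite in_cons xs orbT.
Qed.

Lemma lookup_alists ks vs e d k : e \in alists ks vs ->
  if k \in ks then lookup d e k \in vs else lookup d e k == d.
Proof.
elim: ks e => [|x ks IH] e /=; first by rewrite inE => /eqP ->.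
move=> /allpairsP[[v e'] /= [vv e'v ->]] /=; rewrite in_cons eq_sym.
by case: eqP => //= _; exact: IH.
Qed.

End AssociationLists.

Section ListDestructors.
Context {A B : Type} `{Coded A, Coded B}.

Lemma cmp_head (d : A -> B) (l : A -> seq B) :
  cmp d -> cmp l -> cmp (fun a => head (d a) (l a)).
Proof.
move=> cd cl; apply: (cmp_seqcase l d (fun x => x.2.1)) => //.
by repeat cmp_step.
Qed.

Lemma cmp_behead (l : A -> seq B) : cmp l -> cmp (fun a => behead (l a)).
Proof.
move=> cl; apply: (cmp_seqcase l (fun=> [::]) (fun x => x.2.2)) => //.
  exact: cmp_const.
by repeat cmp_step.
Qed.

End ListDestructors.

(** * Folding over formulas *)

Definition connective (f : form) : nat :=
  match f with
  | fBot => 0 | fAtom _ _ => 1 | fAnd _ _ => 2 | fOr _ _ => 3 | fImp _ _ => 4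
  | fAll _ _ => 5 | fEx _ _ => 6
  end.

Definition binary (f : form) : bool := (1 < connective f) && (connective f < 5).

Definition lsub (f : form) : form :=
  match f with fAnd a _ | fOr a _ | fImp a _ => a | _ => fBot end.

Definition rsub (f : form) : form :=
  match f with
  | fAnd _ b | fOr _ b | fImp _ b | fAll _ b | fEx _ b => b
  | _ => fBot
  end.

Definition qvar (f : form) : nat :=
  match f with fAll x _ | fEx x _ => x | _ => 0 end.

Definition leaf_atoms (f : form) : seq atom :=
  match f with fAtom p ts => [:: (p, ts)] | _ => [::] end.

Lemma code_terms ts : enc_terms ts = code ts.
Proof. by elim: ts => //= t ts ->. Qed.

Section FormDestructors.
Context {A : Type} `{Coded A} (F : A -> form) (cF : cmp F).

Lemma cmp_connective : cmp (fun a => connective (F a)).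
Proof.
apply: (cmp_comp connective) => //; apply: (cmp_lift (fun n => cfst n)); first by repeat cmp_step.
by case=> * /=; rewrite cpairK1.
Qed.

Lemma cmp_lsub : cmp (fun a => lsub (F a)).
Proof.
apply: (cmp_comp lsub) => //.
apply: (cmp_lift (fun n => if (2 <= cfst n) && (cfst n <= 4) then cfst (csnd n) else cpair 0 0)).
  by repeat cmp_step.
by case=> * /=; rewrite ?cpairK.
Qed.

Lemma cmp_rsub : cmp (fun a => rsub (F a)).
Proof.
apply: (cmp_comp rsub) => //.
(* All tags from 2 on store a pair whose second component is the wanted subformula; 0 paired with 0
   is the code of [fBot]. *)
apply: (cmp_lift (fun n => if 2 <= cfst n then csnd (csnd n) else cpair 0 0)).
  by repeat cmp_step.
by case=> * /=; rewrite ?cpairK.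
Qed.

Lemma cmp_qvar : cmp (fun a => qvar (F a)).
Proof.
apply: (cmp_comp qvar) => //.
apply: (cmp_lift (fun n => if 5 <= cfst n then cfst (csnd n) else 0)).
  by repeat cmp_step.
by case=> * /=; rewrite ?cpairK.
Qed.

Lemma cmp_leaf_atoms : cmp (fun a => leaf_atoms (F a)).
Proof.
apply: (cmp_comp leaf_atoms) => //.
(* The payload of tag 1 is already the code of an atom; the successor of its pair with 0 is the code
   of a one-element list. *)
apply: (cmp_lift (fun n => if cfst n == 1 then (cpair (csnd n) 0).+1 else 0)).
  by repeat cmp_step.
by case=> * /=; rewrite ?cpairK //= code_terms.
Qed.

Lemma cmp_binary : cmp (fun a => binary (F a)).
Proof. by rewrite /binary; repeat cmp_step; exact: cmp_connective. Qed.

End FormDestructors.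

Section Fold.
Context {B : Type} (lf : form -> B) (nd : nat -> B -> B -> B).

(* Quantified formulas count as leaves. *)
Fixpoint ffold (f : form) : B :=
  match f with
  | fAnd a b | fOr a b | fImp a b => nd (connective f) (ffold a) (ffold b)
  | _ => lf f
  end.

End Fold.

Fixpoint preorder (f : form) : seq form :=
  match f with
  | fAnd a b | fOr a b | fImp a b => f :: preorder a ++ preorder b
  | _ => [:: f]
  end.

(** One step of the work list: pending formulas on the left, visited ones, latest first, on the
    right. *)
Definition visit (x : seq form * seq form) : seq form * seq form :=
  if x.1 is f :: t then
    (if binary f then lsub f :: rsub f :: t else t, f :: x.2) else x.

Lemma visitP f t out :
  iter (size (preorder f)) visit (f :: t, out) = (t, rev (preorder f) ++ out).
Proof.
(* Common to the three binary connectives: the formula is replaced by its two subformulas, and the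
   left one is exhausted before the right one is reached. *)
have E a b g : binary g -> preorder g = g :: preorder a ++ preorder b ->
    lsub g = a -> rsub g = b ->
    (forall t out, iter (size (preorder a)) visit (a :: t, out) = (t, rev (preorder a) ++ out)) ->
    (forall t out, iter (size (preorder b)) visit (b :: t, out) = (t, rev (preorder b) ++ out)) ->
    forall t out, iter (size (preorder g)) visit (g :: t, out) = (t, rev (preorder g) ++ out).
  move=> bg -> la rb IHa IHb {}t {}out /=.
  rewrite -iterS iterSr size_cat addnC iterD /visit /= bg la rb -/visit IHa IHb.
  by rewrite rev_cons rev_cat cat_rcons catA.
elim: f t out => [|p ts|a IHa b IHb|a IHa b IHb|a IHa b IHb|x a _|x a _] //.
- exact: (E a b (fAnd a b)).
- exact: (E a b (fOr a b)).
- exact: (E a b (fImp a b)).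
Qed.

Lemma size_preorder f : size (preorder f) <= (code f).+1.
Proof.
(* With [z] the inner pair, [m + n] is at most 2z + 2, while a tag of at least 2 makes the whole
   code at least 3z + 3. *)
have E m n k x y : m <= x.+1 -> n <= y.+1 -> 1 < k ->
    m + n < (cpair k (cpair x y)).+1.
  move=> mx ny; case: k => [|[|k]] // _.
  have /= := leq_cpair1 x y; have := leq_cpair2 x y.
  rewrite (cpairE k.+2); set z := cpair x y; rewrite !addSn !triS; lia.
by elim: f => //= a IHa b IHb; rewrite size_cat; exact: E.
Qed.

(** The code bounds the number of steps, and steps after the work list is empty change nothing. *)
Lemma visit_all f :
  iter (code f).+1 visit ([:: f], [::]) = ([::], rev (preorder f)).
Proof.
rewrite -(subnK (size_preorder f)) iterD visitP cats0.
by elim: (_ - _) => //= n ->.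
Qed.

(** A stack machine run on the reversed preorder listing: when a binary formula is met, the value of
    its left part is on top and that of its right part just below. The value at [fBot] is a dummy
    for an empty stack. *)
Definition reduce {B} (lf : form -> B) (nd : nat -> B -> B -> B) (s : seq B) (f : form) : seq B :=
  if binary f then
    nd (connective f) (head (lf fBot) s) (head (lf fBot) (behead s)) :: behead (behead s)
  else lf f :: s.

Lemma reduceP B (lf : form -> B) nd s f :
  foldl (reduce lf nd) s (rev (preorder f)) = ffold lf nd f :: s.
Proof.
elim: f s => //= a IHa b IHb s;
  by rewrite rev_cons rev_cat -cats1 !foldl_cat IHb IHa.
Qed.

Lemma cmp_ffold {A B} `{Coded A, Coded B} (lf : A -> form -> B)
    (nd : A -> nat -> B -> B -> B) (F : A -> form) :
  cmp (fun x : A * form => lf x.1 x.2) ->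
  cmp (fun x : A * (nat * (B * B)) => nd x.1 x.2.1 x.2.2.1 x.2.2.2) ->
  cmp F -> cmp (fun a => ffold (lf a) (nd a) (F a)).
Proof.
move=> cl cn cF.
apply: (@cmp_eq _ _ _ _ (fun a => head (lf a fBot) (foldl (reduce (lf a) (nd a)) [::]
    (iter (code (F a)).+1 visit ([:: F a], [::])).2))).
  by move=> a; rewrite visit_all reduceP.
have cd : cmp (fun a => lf a fBot).
  by apply: (cmp_comp (fun x : A * form => lf x.1 x.2) (fun a => (a, fBot))); repeat cmp_step.
apply: cmp_head => //; apply: (cmp_foldl (fun x => reduce (lf x.1) (nd x.1) x.2.1 x.2.2)).
- apply: cmp_if.
  + by apply: cmp_binary; repeat cmp_step.
  + apply: cmp_cons; last by do 2 apply: cmp_behead; repeat cmp_step.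
    apply: (cmp_comp (fun x : A * (nat * (B * B)) => nd x.1 x.2.1 x.2.2.1 x.2.2.2)
      (fun x : A * (seq B * form) => (x.1, (connective x.2.2, (head (lf x.1 fBot) x.2.1,
         head (lf x.1 fBot) (behead x.2.1)))))) => //.
    have cd' : cmp (fun x : A * (seq B * form) => lf x.1 fBot).
      by apply: (cmp_comp (fun a => lf a fBot)); repeat cmp_step.
    apply: cmp_pair; first by repeat cmp_step.
    apply: cmp_pair; first by apply: cmp_connective; repeat cmp_step.
    apply: cmp_pair; apply: cmp_head => //; last apply: cmp_behead; by repeat cmp_step.
  + apply: cmp_cons; last by repeat cmp_step.
    by apply: (cmp_comp (fun x : A * form => lf x.1 x.2)
      (fun x : A * (seq B * form) => (x.1, x.2.2))); repeat cmp_step.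
- exact: cmp_const.
- apply: cmp_snd; apply: (cmp_iter _ (fun x => visit x.2)).
  + by apply: cmp_succ; exact: cmp_code.
  + apply: (cmp_seqcase (fun x : A * (seq form * seq form) => x.2.1) (fun x => x.2)
      (fun x => (if binary x.2.1 then lsub x.2.1 :: rsub x.2.1 :: x.2.2 else x.2.2,
                 x.2.1 :: x.1.2.2))); repeat cmp_step.
    * by apply: cmp_binary; repeat cmp_step.
    * by apply: cmp_lsub; repeat cmp_step.
    * by apply: cmp_rsub; repeat cmp_step.
  + by repeat cmp_step.
Qed.

Definition unquantify (k : nat) (x : seq nat * form) : seq nat * form :=
  if connective x.2 == k then (qvar x.2 :: x.1, rsub x.2) else x.

(* The variables come out innermost first. *)
Definition strip (k : nat) (f : form) : seq nat * form :=
  iter (code f) (unquantify k) ([::], f).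

Lemma cmp_strip {A} `{Coded A} k (F : A -> form) : cmp F -> cmp (fun a => strip k (F a)).
Proof.
move=> cF; apply: (cmp_iter _ (fun x => unquantify k x.2)).
- exact: cmp_code.
- apply: cmp_if; last by repeat cmp_step.
    by apply: cmp_eqn; [apply: cmp_connective|]; repeat cmp_step.
  apply: cmp_pair; last by apply: cmp_rsub; repeat cmp_step.
  by apply: cmp_cons; [apply: cmp_qvar|]; repeat cmp_step.
- by repeat cmp_step.
Qed.

(** Each quantifier increases the code, so [code] is enough fuel to remove the whole prefix; the
    remaining iterations are idle because [g] does not have tag [k]. *)
Lemma strip_quantifiers k (q : nat -> form -> form) g xs :
  (forall x a, [/\ connective (q x a) = k, qvar (q x a) = x, rsub (q x a) = a & code a < code (q x a)]) ->
  connective g != k -> strip k (foldr q g xs) = (rev xs, g).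
Proof.
move=> qP gk.
have E n : iter n (unquantify k) (rev xs, g) = (rev xs, g).
  by elim: n => //= n ->; rewrite /unquantify (negbTE gk).
have szP : size xs <= code (foldr q g xs).
  elim: xs {E} => //= x xs IH; have [_ _ _ lt] := qP x (foldr q g xs).
  exact: leq_ltn_trans IH lt.
rewrite /strip -(subnK szP) iterD -[RHS](E (code (foldr q g xs) - size xs)).
congr (iter _ _ _).
rewrite -[rev xs]cats0; elim: xs [::] {E szP} => //= x xs IH s.
rewrite -iterS iterSr {2}/unquantify /=.
have [-> -> -> _] := qP x (foldr q g xs); rewrite eqxx IH.
by rewrite rev_cons cat_rcons.
Qed.

(** Putting the removed quantifiers back is an invariant of the iteration, so this holds for
    formulas of any shape. *)
Lemma strip_inv k (q : nat -> form -> form) f :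
  (forall h, connective h = k -> q (qvar h) (rsub h) = h) ->
  f = foldr q (strip k f).2 (rev (strip k f).1).
Proof.
move=> qP; rewrite /strip; elim: (code f) => //= n.
set x := iter n _ _ => IH; rewrite {1}IH /unquantify; case: eqP => //= tk.
by rewrite rev_cons -cats1 foldr_cat /= qP.
Qed.

(** * The decision procedure *)

(** Quantified formulas reach the leaf function with tag 5 or 6 and are rejected there. *)
Definition qfree_test (f : form) : bool :=
  ffold (fun f => connective f <= 1) (fun _ b c => b && c) f.

Definition atoms (f : form) : seq atom := ffold leaf_atoms (fun _ => cat) f.

Definition terms (f : form) : seq term := flatten [seq a.2 | a <- atoms f].

Definition subst (e : seq (term * term)) (t : term) : term := lookup t e t.

Definition inst (e : seq (term * term)) (a : atom) : atom :=
  (a.1, [seq subst e t | t <- a.2]).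

Definition goedel (K k i j : nat) : nat :=
  if k == 2 then minn i j else if k == 3 then maxn i j
  else if i <= j then K else j.

(* Truth values are 0, ..., K, with K the top element. *)
Definition peval (K : nat) (e : seq (term * term)) (w : seq (atom * nat)) (f : form) : nat :=
  ffold (fun g => head 0 [seq lookup 0 w (inst e a) | a <- leaf_atoms g]) (goedel K) f.

(** The Herbrand universe treats variables as constants, which is how the universal variables enter;
    [tConst 0] keeps it nonempty. *)
Definition instances (ys : seq nat) (psi : form) : seq (seq (term * term)) :=
  alists [seq tVar y | y <- ys] (tConst 0 :: terms psi).

Definition ground (ys : seq nat) (psi : form) : seq atom :=
  [seq inst e a | e <- instances ys psi, a <- atoms psi].

(** [Kf] picks the top of the chain from the number of ground atoms, counted with repetitions. *)
Definition tautology_test (Kf : nat -> nat) (ys : seq nat) (psi : form) : bool :=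
  all (fun w => has (fun e => peval (Kf (size (ground ys psi))) e w psi
                                == Kf (size (ground ys psi))) (instances ys psi))
      (alists (ground ys psi) (iota 0 (Kf (size (ground ys psi))).+1)).

Definition bound_in (xs : seq nat) (t : term) : bool :=
  if t is tVar x then x \in xs else true.

Definition matrix_test (Kf : nat -> nat) (xs ys : seq nat) (psi : form) : bool :=
  [&& qfree_test psi, all (bound_in (xs ++ ys)) (terms psi) & tautology_test Kf ys psi].

Definition decide (Kf : nat -> nat) (f : form) : bool :=
  matrix_test Kf (strip 5 f).1 (strip 6 (strip 5 f).2).1 (strip 6 (strip 5 f).2).2.

Lemma cmp_atoms {A} `{Coded A} (F : A -> form) : cmp F -> cmp (fun a => atoms (F a)).
Proof.
move=> cF; apply: (cmp_ffold (fun _ => leaf_atoms) (fun _ _ => cat)) => //.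
  by apply: cmp_leaf_atoms; repeat cmp_step.
by repeat cmp_step.
Qed.

Lemma cmp_terms {A} `{Coded A} (F : A -> form) : cmp F -> cmp (fun a => terms (F a)).
Proof.
move=> cF; rewrite /terms; repeat cmp_step; first exact: cmp_atoms.
Qed.

Lemma cmp_qfree_test {A} `{Coded A} (F : A -> form) : cmp F -> cmp (fun a => qfree_test (F a)).
Proof.
move=> cF; apply: (cmp_ffold (fun _ f => connective f <= 1) (fun _ _ b c => b && c)) => //.
  by repeat cmp_step; apply: cmp_connective; repeat cmp_step.
by repeat cmp_step.
Qed.

Lemma cmp_tVar {A} `{Coded A} (f : A -> nat) : cmp f -> cmp (fun a => tVar (f a)).
Proof.
move=> cf; apply: (cmp_comp tVar) => //.
by apply: (cmp_lift (fun n => cpair 0 n)) => //; repeat cmp_step.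
Qed.

Lemma cmp_instances {A} `{Coded A} (ys : A -> seq nat) (F : A -> form) :
  cmp ys -> cmp F -> cmp (fun a => instances (ys a) (F a)).
Proof.
move=> cy cF; apply: cmp_alists; repeat cmp_step; last exact: cmp_terms.
by apply: cmp_tVar; repeat cmp_step.
Qed.

Lemma cmp_inst {A} `{Coded A} (e : A -> seq (term * term)) (F : A -> atom) :
  cmp e -> cmp F -> cmp (fun a => inst (e a) (F a)).
Proof.
move=> ce cF; apply: cmp_pair; first exact: cmp_fst.
apply: cmp_map; last exact: cmp_snd.
apply: cmp_lookup; first exact: code_term_inj.
- by repeat cmp_step.
- by apply: (cmp_comp e); repeat cmp_step.
- by repeat cmp_step.
Qed.

Lemma cmp_ground {A} `{Coded A} (ys : A -> seq nat) (F : A -> form) :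
  cmp ys -> cmp F -> cmp (fun a => ground (ys a) (F a)).
Proof.
move=> cy cF; apply: cmp_flatten; apply: cmp_map; last exact: cmp_instances.
apply: cmp_map; last by apply: cmp_atoms; apply: (cmp_comp F); repeat cmp_step.
by apply: cmp_inst; repeat cmp_step.
Qed.

Lemma cmp_peval {A} `{Coded A} (K : A -> nat) (e : A -> seq (term * term)) (w : A -> seq (atom * nat))
    (F : A -> form) :
  cmp K -> cmp e -> cmp w -> cmp F -> cmp (fun a => peval (K a) (e a) (w a) (F a)).
Proof.
move=> cK ce cw cF.
apply: (cmp_ffold (fun a g => head 0 [seq lookup 0 (w a) (inst (e a) x) | x <- leaf_atoms g])
  (fun a => goedel (K a))) => //.
  apply: cmp_head; first by repeat cmp_step.
  apply: cmp_map; last by apply: cmp_leaf_atoms; repeat cmp_step.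
  apply: cmp_lookup; first exact: code_atom_inj.
  - by repeat cmp_step.
  - by apply: (cmp_comp w); repeat cmp_step.
  - by apply: cmp_inst; [apply: (cmp_comp e)|]; repeat cmp_step.
rewrite /goedel; repeat cmp_step.
by apply: (cmp_comp K); repeat cmp_step.
Qed.

Lemma cmp_tautology_test {A} `{Coded A} (Kf : nat -> nat) (ys : A -> seq nat) (F : A -> form) :
  cmp Kf -> cmp ys -> cmp F -> cmp (fun a => tautology_test Kf (ys a) (F a)).
Proof.
move=> cK cy cF.
have cS : cmp (fun a => Kf (size (ground (ys a) (F a)))).
  by apply: (cmp_comp Kf) => //; apply: cmp_size; exact: cmp_ground.
apply: cmp_all; last by apply: cmp_alists; [exact: cmp_ground | repeat cmp_step].
apply: cmp_has; last by apply: cmp_instances; [apply: (cmp_comp ys)|apply: (cmp_comp F)]; repeat cmp_step.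
pose S a := Kf (size (ground (ys a) (F a))).
have cS' : cmp (fun x : A * seq (atom * nat) * seq (term * term) => S x.1.1).
  by apply: (cmp_comp S); repeat cmp_step.
apply: cmp_eqn => //; apply: cmp_peval => //; first by repeat cmp_step.
  by repeat cmp_step.
by apply: (cmp_comp F); repeat cmp_step.
Qed.

Lemma cmp_decide (Kf : nat -> nat) : cmp Kf -> cmp (decide Kf).
Proof.
move=> cK.
have c5 : cmp (fun f => strip 5 f) by apply: cmp_strip; repeat cmp_step.
have c6 : cmp (fun f => strip 6 (strip 5 f).2) by apply: cmp_strip; repeat cmp_step.
have cp : cmp (fun f => (strip 6 (strip 5 f).2).2) by apply: cmp_snd.
rewrite /decide /matrix_test; apply: cmp_and; first exact: cmp_qfree_test.
apply: cmp_and; last by apply: cmp_tautology_test => //; exact: cmp_fst.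
apply: cmp_all; last exact: cmp_terms.
(* On codes, a variable is recognized by the first component 0 and its index is the second
   component. *)
apply: (@cmp_eq _ _ _ _ (fun x : form * term => if cfst (code x.2) == 0 then
    csnd (code x.2) \in (strip 5 x.1).1 ++ (strip 6 (strip 5 x.1).2).1 else true)).
  by case=> f [] n; rewrite /= !cpairK.
have ct : cmp (fun x : form * term => code x.2) by apply: cmp_code; repeat cmp_step.
repeat cmp_step => //.
- by apply: (cmp_comp (fun f => strip 5 f)); repeat cmp_step.
- by apply: (cmp_comp (fun f => strip 6 (strip 5 f).2)); repeat cmp_step.
Qed.

Lemma ltn_quantifier k x n : 0 < k -> n < cpair k (cpair x n).
Proof. by move=> k0; exact: leq_ltn_trans (leq_cpair2 x n) (ltn_cpair2 k _ k0). Qed.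

(** * Correctness *)

Lemma qfree_testE f : qfree_test f = qfree f.
Proof. by elim: f => //= a IHa b IHb; rewrite -IHa -IHb. Qed.

Lemma terms_atom p ts : terms (fAtom p ts) = ts.
Proof. exact: cats0. Qed.

Lemma flatten_terms_cat a b :
  flatten [seq x.2 | x <- atoms a ++ atoms b] = terms a ++ terms b.
Proof. by rewrite map_cat flatten_cat. Qed.

Lemma qfree_free_in x f : qfree f -> free_in x f = (tVar x \in terms f).
Proof.
elim: f => //= [p ts _|a IHa b IHb|a IHa b IHb|a IHa b IHb].
  rewrite terms_atom -has_pred1; apply: eq_has => -[n|n] /=; last exact/esym/eqP.
  by apply/eqP/eqP => [->|[]].
all: by case/andP=> qa qb; rewrite /terms /= flatten_terms_cat mem_cat IHa ?IHb.
Qed.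

Lemma free_in_prefix (q : nat -> form -> form) xs x g :
  (forall y a, free_in x (q y a) = (y != x) && free_in x a) ->
  free_in x (foldr q g xs) = (x \notin xs) && free_in x g.
Proof.
move=> qP; elim: xs => //= y xs IH; rewrite qP IH in_cons negb_or eq_sym.
by rewrite andbA.
Qed.

Definition matrix (f : form) : form := (strip 6 (strip 5 f).2).2.

Lemma strip_prefix f :
  f = foldr fAll (foldr fEx (matrix f) (rev (strip 6 (strip 5 f).2).1)) (rev (strip 5 f).1).
Proof. by rewrite /matrix -strip_inv -?strip_inv //; case. Qed.

(** A quantifier-free matrix determines the prefix, so stripping recovers any given decomposition up
    to the order of the variable lists. Closedness then says that every variable of the matrix is in
    the prefix. *)
Lemma BS_decide f : BS f <->
  qfree (matrix f) /\
  all (bound_in ((strip 5 f).1 ++ (strip 6 (strip 5 f).2).1)) (terms (matrix f)).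
Proof.
have closed_terms xs ys psi : qfree psi ->
    sentence (foldr fAll (foldr fEx psi ys) xs) <-> all (bound_in (xs ++ ys)) (terms psi).
  move=> qf; have fE x : free_in x (foldr fAll (foldr fEx psi ys) xs) =
      (x \notin xs ++ ys) && (tVar x \in terms psi).
    by rewrite !free_in_prefix // qfree_free_in // mem_cat negb_or andbA.
  split=> [cl|/allP al x].
    apply/allP => -[n|n] //= nt; move: (cl n); rewrite fE nt andbT.
    by move/negbFE.
  by rewrite fE; apply/negP => /andP[nx /al /=]; rewrite (negbTE nx).
split.
  move=> [xs [ys [psi [qf [E cl]]]]].
  (* A quantifier-free matrix has tag at most 4, so neither [strip 5] nor [strip 6] removes anything
     from it. *)
  have gt : connective psi <= 4 by case: psi qf {E cl}.
  have sp5 : strip 5 f = (rev xs, foldr fEx psi ys).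
    rewrite E; apply: strip_quantifiers; last by case: (ys) => //; case: psi gt {qf E cl}.
    by move=> x a; split=> //; exact: (ltn_quantifier 5 x (enc a)).
  rewrite /matrix sp5 /= strip_quantifiers /=; last by case: psi gt {qf E cl sp5}.
    split=> //; move: cl; rewrite E closed_terms //.
    by rewrite (eq_all (a2 := bound_in (xs ++ ys))) // => -[] //= n; rewrite !mem_cat !mem_rev.
  by move=> x a; split=> //; exact: (ltn_quantifier 6 x (enc a)).
move=> [qf al]; exists (rev (strip 5 f).1), (rev (strip 6 (strip 5 f).2).1), (matrix f).
split=> //; split; first exact: strip_prefix.
rewrite {1}[f]strip_prefix closed_terms // (eq_all (a2 := bound_in ((strip 5 f).1 ++ (strip 6 (strip 5 f).2).1))) //.
by case=> //= n; rewrite !mem_cat !mem_rev.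
Qed.

(** * Semantics over a Gödel set and Herbrand's theorem *)

Import Order.TTheory GRing.Theory Num.Theory.
Local Open Scope classical_set_scope.
Local Open Scope ring_scope.

Section Semantics.
Context {R : realType} {V : set R} (HV : goedel_set R V).
Implicit Types (I J : interp R V) (psi : form).

Lemma V01 x : V x -> 0 <= x <= 1.
Proof. by case: HV => _ [/(_ x)]. Qed.

Lemma V0 : V 0. Proof. by case: HV => _ [_ []]. Qed.
Lemma V1 : V 1. Proof. by case: HV => _ [_ []]. Qed.

(** Keeps the sets under the quantifiers bounded, which the order properties of [inf] and [sup]
    require; [idom_pt] makes them nonempty. *)
Lemma feval01 I s psi : 0 <= feval R V I s psi <= 1.
Proof.
elim: psi s => /= [|p ts|a IHa b IHb|a IHa b IHb|a IHa b IHb|x a IH|x a IH] s.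
- by rewrite lexx ler01.
- exact: (V01 _ (ipred_V _ _ I _ _)).
- have /andP[a0 a1] := IHa s; have /andP[b0 b1] := IHb s.
  by rewrite le_min a0 b0 /= ge_min a1.
- have /andP[a0 a1] := IHa s; have /andP[b0 b1] := IHb s.
  by rewrite le_max a0 /= ge_max a1.
- by case: ifP => _; rewrite ?lexx ?ler01.
- set E := [set _ | _ in _].
  have E01 y : E y -> 0 <= y <= 1 by case=> u _ <-.
  have [y Ey] : E !=set0 by exists (feval R V I (upd _ s x (idom_pt _ _ I)) a), (idom_pt _ _ I).
  have E0 : lbound E 0 by move=> z /E01 /andP[].
  rewrite lb_le_inf //=; last by exists y.
  have /andP[_ y1] := E01 y Ey; apply: le_trans y1; apply: ge_inf => //.
  by exists 0.
- set E := [set _ | _ in _].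
  have E01 y : E y -> 0 <= y <= 1 by case=> u _ <-.
  have [y Ey] : E !=set0 by exists (feval R V I (upd _ s x (idom_pt _ _ I)) a), (idom_pt _ _ I).
  have E1 : ubound E 1 by move=> z /E01 /andP[].
  rewrite ge_sup ?andbT //; last by exists y.
  have /andP[y0 _] := E01 y Ey; apply: le_trans y0 _; apply: ub_le_sup => //.
  by exists 1.
Qed.

(** Together with [ex_le], this treats a block of existential quantifiers as one supremum over the
    assignments that agree with [s] outside [ys]. *)
Lemma feval_le_ex I s s' ys psi :
  (forall n, n \notin ys -> s' n = s n) ->
  feval R V I s' psi <= feval R V I s (foldr fEx psi ys).
Proof.
elim: ys s => [|y ys IH] s /= ss'.
  by have -> : s' = s by apply/funext => n; exact: ss'.
have /IH/le_trans : forall n, n \notin ys -> s' n = upd _ s y (s' y) n.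
  move=> n nys; rewrite /upd; case: eqP => [-> //|/eqP ny].
  by rewrite ss' // in_cons negb_or ny.
apply; apply: ub_le_sup; last by exists (s' y).
by exists 1 => _ [u _ <-]; case/andP: (feval01 I (upd _ s y u) (foldr fEx psi ys)).
Qed.

Lemma ex_le I s ys psi c :
  (forall s', (forall n, n \notin ys -> s' n = s n) -> feval R V I s' psi <= c) ->
  feval R V I s (foldr fEx psi ys) <= c.
Proof.
elim: ys s => [|y ys IH] s /= le_c; first exact: le_c.
apply: ge_sup.
  by exists (feval R V I (upd _ s y (idom_pt _ _ I)) (foldr fEx psi ys)), (idom_pt _ _ I).
move=> _ [u _ <-]; apply: IH => s' ss'; apply: le_c => n.
rewrite in_cons negb_or => /andP[ny nys]; rewrite ss' // /upd.
by rewrite (negbTE ny).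
Qed.

(** Validity already ranges over all assignments, so a universal variable may be left free: the
    infimum is below each value, and an infimum of values 1 is 1. *)
Lemma valid_all x g : valid_GV R V (fAll x g) <-> valid_GV R V g.
Proof.
split=> [val I s|val I s] /=.
  apply/eqP; rewrite eq_le; have /andP[_ -> /=] := feval01 I s g.
  rewrite -(val I s) /=; apply: ge_inf.
    by exists 0 => _ [u _ <-]; case/andP: (feval01 I (upd _ s x u) g).
  exists (s x) => //; congr feval; apply/funext => n; rewrite /upd.
  by case: eqP => // ->.
rewrite (_ : [set _ | _ in _] = [set 1]) ?inf1 //.
apply/seteqP; split=> [_ [u _ <-]|_ ->] /=; first exact: val.
by exists (idom_pt _ _ I).
Qed.

Lemma valid_all_prefix xs g : valid_GV R V (foldr fAll g xs) <-> valid_GV R V g.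
Proof. by elim: xs => //= x xs IH; rewrite valid_all. Qed.

(** Used twice for Herbrand's theorem: for a map that identifies terms, and for the evaluation of
    terms in a given interpretation. *)
Lemma feval_hom I J (h : idom R V I -> idom R V J) s s' psi :
  qfree psi -> (forall p l, ipred R V I p l = ipred R V J p (map h l)) ->
  (forall t, t \in terms psi -> h (teval R V I s t) = teval R V J s' t) ->
  feval R V I s psi = feval R V J s' psi.
Proof.
move=> + hP; elim: psi => //= [p ts _|a IHa b IHb|a IHa b IHb|a IHa b IHb].
  rewrite terms_atom => st; rewrite hP -map_comp; congr ipred.
  by apply/eq_in_map => t /st.
all: case/andP=> qa qb; rewrite /terms /= flatten_terms_cat => st.
all: rewrite IHa ?IHb // => t tt'; apply: st; rewrite mem_cat tt' ?orbT //.
Qed.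

(** The Herbrand interpretation with atom values prescribed by [v]; variables belong to its domain
    as well. *)
Definition term_interp (v : atom -> R) (vV : forall a, V (v a)) : interp R V :=
  Interp R V term (tConst 0) tConst (fun p ts => v (p, ts)) (fun p ts => vV (p, ts)).

Definition valuation (e : seq (term * term)) (n : nat) : term := subst e (tVar n).

Lemma subst_const ys psi e c : e \in instances ys psi -> subst e (tConst c) = tConst c.
Proof.
move=> /(lookup_alists _ _ _ (tConst c) (tConst c)); case: ifP => [|_ /eqP //].
by case/mapP.
Qed.

Lemma teval_valuation v vV e t : (forall c, subst e (tConst c) = tConst c) ->
  teval R V (term_interp v vV) (valuation e) t = subst e t.
Proof. by case: t => //= n ->. Qed.

(** Finitely many values below 1 have a common bound below 1; this is what forces some instance to
    reach the value 1. *)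
Lemma max_lt1 (T : eqType) (E : seq T) (g : T -> R) :
  (forall x, x \in E -> g x < 1) -> exists2 c, c < 1 & forall x, x \in E -> g x <= c.
Proof.
elim: E => [|x E IH] lt1; first by exists 0.
have [|c c1 le_c] := IH; first by move=> y yE; rewrite lt1 // in_cons yE orbT.
exists (Num.max (g x) c); first by rewrite gt_max c1 lt1 ?mem_head.
move=> y; rewrite in_cons => /orP[/eqP ->|/le_c yc]; first by rewrite le_max lexx.
by rewrite le_max yc orbT.
Qed.

(* Herbrand's theorem: in a counterexample over the terms, all terms that do not occur in [psi] can be identified with a constant, which leaves finitely many instances, so the supremum is attained. *)
Lemma valid_herbrand xs ys zs psi : qfree psi -> zs =i ys ->
  valid_GV R V (foldr fAll (foldr fEx psi zs) xs) <->
  forall v (vV : forall a, V (v a)), exists2 e, e \in instances ys psi &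
    feval R V (term_interp v vV) (valuation e) psi = 1.
Proof.
move=> qf zy; rewrite valid_all_prefix; split=> [val v vV|val I s].
  pose D := tConst 0 :: terms psi.
  (* [h] retracts all terms onto the finite set [D], and [J] reads atoms through [h], so its values
     involve only atoms over [D]. *)
  pose h t := if t \in D then t else tConst 0.
  have hD t : h t \in D by rewrite /h; case: ifP => // _; rewrite mem_head.
  have hid t : t \in D -> h t = t by rewrite /h => ->.
  pose J := Interp R V term (tConst 0) tConst (fun p ts => v (p, map h ts)) (fun p ts => vV (p, map h ts)).
  apply: contrapT => noe.
  have lt1 e : e \in instances ys psi -> feval R V (term_interp v vV) (valuation e) psi < 1.
    move=> eI; rewrite lt_neqAle; have /andP[_ -> /=] := feval01 (term_interp v vV) (valuation e) psi.
    by rewrite andbT; apply/eqP => e1; apply: noe; exists e.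
  have [c c1 le_c] := max_lt1 _ _ _ lt1.
  (* Under [tVar] the free variables denote themselves. It remains to bound every value of the
     existential block by [c]. *)
  move: c1; rewrite -(val J tVar) ltNge => /negP; apply; apply: ex_le => s' ss'.
  (* The instance read off from [s']: each variable of [ys] goes to the representative in [D] of its
     value. *)
  pose e := [seq (k, h (teval R V J s' k)) | k <- [seq tVar y | y <- ys]].
  have eI : e \in instances ys psi by apply: map_in_alists => k _; exact: hD.
  rewrite (feval_hom J (term_interp v vV) h s' (valuation e)) ?le_c // => t tpsi.
  rewrite teval_valuation; last by move=> ?; exact: subst_const eI.
  rewrite /subst lookup_map; case: ifP => // tys.
  have tD : t \in D by rewrite in_cons tpsi orbT.
  case: t {tpsi} tys tD => [n|n] /= tys tD; last by rewrite hid.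
  (* A variable outside [ys] still denotes itself, and [h] fixes it because it occurs in [psi]. *)
  rewrite ss' ?hid // zy; apply/negP => nys.
  by move/negP: tys; apply; exact: map_f.
apply/eqP; rewrite eq_le; have /andP[_ -> /=] := feval01 I s (foldr fEx psi zs).
(* Pulling [I] back along the evaluation of terms turns that evaluation into a homomorphism from the
   term interpretation, so the instance found there yields witnesses in [I]. *)
pose v (a : atom) := ipred R V I a.1 (map (teval R V I s) a.2).
have vV a : V (v a) by exact: ipred_V.
have [e eI <-] := val v vV.
pose s' n := teval R V I s (valuation e n).
rewrite (feval_hom (term_interp v vV) I (teval R V I s) (valuation e) s') //; last first.
  by case=> [n|n] _.
apply: feval_le_ex => n; rewrite zy => nys; rewrite /s' /valuation /subst.
have := lookup_alists _ _ _ (tVar n) (tVar n) eI.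
case: ifP => [/mapP[m mys [nm]]|_ /eqP -> //].
by move: nys; rewrite nm mys.
Qed.

(** * Reduction to finite chains *)

(** The connectives use only 0, 1 and the order and return one of their arguments, 0 or 1. A
    relation rather than a function serves both directions: ranks of real values, and a chain
    embedded into [V]. *)
Lemma peval_rel (S : R -> nat -> Prop) K v (vV : forall a, V (v a)) e w psi :
  S 0 0%N -> S 1 K ->
  (forall x y i j, S x i -> S y j -> (x <= y) = (i <= j)%N) ->
  qfree psi -> (forall c, subst e (tConst c) = tConst c) ->
  (forall a, a \in atoms psi -> S (v (inst e a)) (lookup 0%N w (inst e a))) ->
  S (feval R V (term_interp v vV) (valuation e) psi) (peval K e w psi).
Proof.
move=> S0 S1 Sle + ec; rewrite /peval /atoms.
have sub_cat (s t : seq atom) : (forall a, a \in s ++ t -> S (v (inst e a)) (lookup 0%N w (inst e a))) ->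
    (forall a, a \in s -> S (v (inst e a)) (lookup 0%N w (inst e a))) /\
    (forall a, a \in t -> S (v (inst e a)) (lookup 0%N w (inst e a))).
  by move=> st; split=> a ain; apply: st; rewrite mem_cat ain ?orbT.
elim: psi => //= [p ts _|a IHa b IHb|a IHa b IHb|a IHa b IHb].
  move/(_ (p, ts) (mem_head _ _)); congr (S _ _); rewrite /inst /=; congr (v (_, _)).
  by apply: eq_map => t; rewrite teval_valuation.
all: case/andP=> qa qb /sub_cat[/(IHa qa) Sa /(IHb qb) Sb]; have le_ab := Sle _ _ _ _ Sa Sb.
all: rewrite /goedel /=.
- by rewrite minEle le_ab; case: leqP.
- by rewrite maxEle le_ab; case: leqP.
- by rewrite le_ab; case: ifP.
Qed.

(* [n.+2] counts the values of [n] atoms together with 0 and 1. *)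
Definition adequate (K n : nat) : Prop :=
  (exists l : seq R, [/\ uniq l, size l = K.+1 & {in l, forall x, V x}]) /\
  (forall l : seq R, uniq l -> {in l, forall x, V x} ->
     (size l <= n.+2 -> size l <= K.+1)%N).

Lemma adequate_gt0 K n : adequate K n -> (0 < K)%N.
Proof.
case=> _ /(_ [:: 0; 1]) /=; rewrite inE eq_sym oner_eq0; apply=> //.
by move=> x; rewrite !inE => /orP[] /eqP ->; [exact: V0 | exact: V1].
Qed.

(** The distinction between infinite and finite [V] is classical; it only selects between the
    successor function and a constant, both computable. *)
Lemma exists_adequate : exists2 Kf, cmp Kf & forall n, adequate (Kf n) n.
Proof.
pose Q n := `[< exists l : seq R, [/\ uniq l, size l = n & {in l, forall x, V x}] >].
have Q2 : Q 2%N.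
  apply/asboolP; exists [:: 0; 1]; split=> //=; first by rewrite inE eq_sym oner_eq0.
  by move=> x; rewrite !inE => /orP[] /eqP ->; [exact: V0 | exact: V1].
have [allQ|] := pselect (forall n, Q n).
  exists succn; first by apply: cmp_succ; exact: cmp_id.
  by move=> n; split=> //; exact/asboolP/allQ.
move=> /existsNP[m nQm].
have le_m n : Q n -> (n <= m)%N.
  move=> /asboolP[l [ul sl lV]]; rewrite leqNgt; apply/negP => mn; apply: nQm.
  apply/asboolP; exists (take m l); split; first exact: take_uniq.
    by rewrite size_take sl mn.
  by move=> x /mem_take; exact: lV.
have exQ : exists n, Q n by exists 2%N.
(* Here [K] is the cardinality of [V], so the top of the chain is [K.-1]. *)
case: (ex_maxnP exQ le_m) => K QK maxK.
exists (fun=> K.-1); first exact: cmp_const.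
have K0 : (0 < K)%N by exact: leq_trans (maxK _ Q2).
move=> n; split; first by rewrite prednK //; exact/asboolP.
by move=> l ul lV _; rewrite prednK //; apply: maxK; apply/asboolP; exists l.
Qed.

(** Sorting the given [K.+1] elements together with 0 and 1 leaves more than [K] entries, the least
    being 0. The first [K] of them are followed by 1. *)
Lemma chain_of_adequate K n : adequate K n ->
  exists g : nat -> R, [/\ g 0%N = 0, g K = 1, forall i, V (g i) &
    forall i j, (i <= K)%N -> (j <= K)%N -> (g i <= g j) = (i <= j)%N].
Proof.
move=> ad; have K0 := adequate_gt0 _ _ ad; case: ad => -[l0 [ul0 sl0 lV0]] _.
pose l := sort <=%R (undup (0 :: 1 :: l0)).
have lV x : x \in l -> V x.
  rewrite mem_sort mem_undup !in_cons => /or3P[/eqP ->|/eqP ->|]; [exact: V0|exact: V1|exact: lV0].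
have sl : (K < size l)%N.
  rewrite -sl0 size_sort; apply: uniq_leq_size => // x xl.
  by rewrite mem_undup !in_cons xl !orbT.
have lts : sorted <%R l by rewrite lt_sorted_uniq_le sort_uniq undup_uniq sort_le_sorted.
have lt_nth i j : (i < j)%N -> (j < size l)%N -> nth 0 l i < nth 0 l j.
  move=> ij js; apply: (sorted_ltn_nth lt_trans) => //; rewrite ?inE //.
  exact: ltn_trans js.
have nthV i : V (nth 0 l i).
  by have [/mem_nth/lV //|/(nth_default 0) ->] := ltnP i (size l); exact: V0.
(* The entry at index [K] may lie below 1, so 1 is put there. Outside the list the default 0 is
   still in [V]. *)
exists (fun i => if i == K then 1 else nth 0 l i); rewrite eqxx; split => //.
- rewrite eq_sym gtn_eqF //.
  have l_0 : 0 \in l by rewrite mem_sort mem_undup mem_head.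
  have [i0|i0] := posnP (index 0 l); first by rewrite -[X in nth _ _ X]i0 nth_index.
  have := lt_nth _ _ i0; rewrite index_mem l_0 nth_index // => /(_ isT).
  by rewrite ltNge; case/andP: (V01 _ (nthV 0%N)) => ->.
- by move=> i; case: ifP => // _; exact: V1.
have lt1 i : (i < K)%N -> nth 0 l i < 1.
  move=> iK; apply: lt_le_trans (lt_nth _ K iK sl) _.
  by case/andP: (V01 _ (nthV K)).
have mono i j : (i < j)%N -> (j <= K)%N -> 
   (if i == K then 1 else nth 0 l i) < (if j == K then 1 else nth 0 l j).
  move=> ij jK; rewrite (ltn_eqF (leq_trans ij jK)); case: eqP => [jE|_]; first by rewrite lt1 // -jE.
  by apply: lt_nth => //; exact: leq_ltn_trans sl.
move=> i j iK jK; case: (ltngtP i j) => [ij|ji|->]; last by rewrite lexx.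
  by rewrite ltW // mono.
by apply/negbTE; rewrite -ltNge mono.
Qed.

(** The rank of a value is the number of distinct values below it, except that 1 is lifted to
    [K]. *)
Lemma rank_of_adequate K n (L0 : seq R) : adequate K n -> (size L0 <= n)%N ->
  {in L0, forall x, V x} ->
  exists r : R -> nat, [/\ r 0 = 0%N, r 1 = K &
    {in 0 :: 1 :: L0 &, forall x y, (x <= y) = (r x <= r y)%N}].
Proof.
move=> [_ ad] sL0 L0V; pose L : seq R := undup (0 :: 1 :: L0).
have memL (x : R) : (x \in L) = (x \in 0 :: 1 :: L0) by rewrite mem_undup.
have LV (x : R) : x \in L -> V x.
  by rewrite memL !in_cons => /or3P[/eqP ->|/eqP ->|]; [exact: V0|exact: V1|exact: L0V].
have sL : (size L <= K.+1)%N.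
  apply: ad => //; first exact: undup_uniq.
  by apply: leq_trans (size_undup _) _ => /=; rewrite !ltnS.
pose c (x : R) := count (fun y => y < x) L.
have cE x : c x = size [seq y <- L | y < x] by rewrite size_filter.
have uL (x : R) : uniq [seq y <- L | y < x] by rewrite filter_uniq ?undup_uniq.
have lt_c (x y : R) : x \in L -> x < y -> (c x < c y)%N.
  move=> xL xy; rewrite !cE.
  apply: (@uniq_leq_size _ (x :: [seq z <- L | z < x])) => [|z].
    by rewrite /= mem_filter ltxx uL.
  rewrite in_cons !mem_filter => /orP[/eqP ->|/andP[zx ->]]; first by rewrite xy.
  by rewrite (lt_trans zx xy).
have c1 : (c 1%R < size L)%N.
  rewrite cE; apply: (@uniq_leq_size _ (1 :: [seq z <- L | z < 1])) => [|z].
    by rewrite /= mem_filter ltxx uL.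
  rewrite in_cons mem_filter => /orP[/eqP ->|/andP[]//].
  by rewrite memL !in_cons eqxx orbT.
(* By [c1] and [sL] the count at 1 is at most [K], so the lift keeps 1 strictly above all other
   ranks. *)
exists (fun x => if x == 1 then K else c x); rewrite eqxx eq_sym oner_eq0.
have mono (x y : R) : x \in L -> y \in L -> x < y ->
    ((if x == 1%R then K else c x) < (if y == 1%R then K else c y))%N.
  move=> xL yL xy.
  have x1 : x < 1 by case/andP: (V01 _ (LV y yL)) => _; exact: lt_le_trans.
  rewrite (lt_eqF x1); case: eqP => _; last exact: lt_c.
  exact: leq_trans (lt_c _ _ xL x1) (leq_trans c1 sL).
split=> //.
  apply/eqP; rewrite /c -leqn0 leqNgt -has_count; apply/hasPn => x /LV/V01/andP[x0 _].
  by rewrite -leNgt.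
move=> x y; rewrite -!memL => xL yL.
case: (ltgtP x y) => [xy|yx|->]; last by rewrite leqnn.
  by rewrite ltnW // mono.
by apply/esym/negbTE; rewrite -ltnNge mono.
Qed.

Lemma iota_K K i : (i \in iota 0 K.+1) = (i <= K)%N.
Proof. by rewrite mem_iota. Qed.

(** A valuation in [V] is replaced by the ranks of its values on the ground atoms; conversely, a
    valuation in the chain is embedded into [V]. In both cases [peval_rel] carries the value 1
    over. *)
Lemma tautology_testP Kf ys psi : (forall n, adequate (Kf n) n) -> qfree psi ->
  tautology_test Kf ys psi <->
  forall v (vV : forall a, V (v a)), exists2 e, e \in instances ys psi &
    feval R V (term_interp v vV) (valuation e) psi = 1.
Proof.
move=> adK qf; rewrite /tautology_test.
set As := ground ys psi; set K := Kf _.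
have ad : adequate K (size As) by exact: adK.
have inAs e a : e \in instances ys psi -> a \in atoms psi -> inst e a \in As.
  by move=> eI aA; apply/allpairsP; exists (e, a).
split=> [/allP test v vV|val].
  have [|x /mapP[a _ ->] //|r [r0 r1 rle]] := rank_of_adequate K _ (map v As) ad.
    by rewrite size_map.
  (* The rank respects the order only on these finitely many values, so membership is part of the
     relation. *)
  pose S x i := x \in 0 :: 1 :: map v As /\ i = r x.
  have S0 : S 0 0%N by split; rewrite ?mem_head.
  have S1 : S 1 K by split; rewrite // !in_cons eqxx orbT.
  have Sle x y i j : S x i -> S y j -> (x <= y) = (i <= j)%N.
    by move=> [xL ->] [yL ->]; exact: rle.
  have vS a : a \in As -> S (v a) (r (v a)).
    by move=> aA; split=> //; rewrite !in_cons map_f ?orbT.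
  have /test/hasP[e eI /eqP pe] : [seq (a, r (v a)) | a <- As] \in alists As (iota 0 K.+1).
    apply: map_in_alists => a /vS Sa; rewrite iota_K -(Sle _ _ _ _ Sa S1).
    by case/andP: (V01 _ (vV a)).
  exists e => //.
  have : S (feval R V (term_interp v vV) (valuation e) psi) K.
    rewrite -pe; apply: peval_rel => // [c|a aA]; first exact: subst_const eI.
    by rewrite lookup_map inAs //; apply: vS; exact: inAs.
  move=> SK; apply/eqP; rewrite eq_le (Sle _ _ _ _ SK S1) (Sle _ _ _ _ S1 SK).
  by rewrite leqnn.
have [g [g0 g1 gV gle]] := chain_of_adequate _ _ ad.
apply/allP => w wA.
have wK a : (lookup 0%N w a <= K)%N.
  have := lookup_alists _ _ _ 0%N a wA; case: ifP => [_|_ /eqP -> //].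
  by rewrite iota_K.
have [e eI e1] := val (fun a => g (lookup 0%N w a)) (fun a => gV _).
apply/hasP; exists e => //.
pose S x i := (i <= K)%N /\ x = g i.
have Sle x y i j : S x i -> S y j -> (x <= y) = (i <= j)%N.
  by move=> [iK ->] [jK ->]; exact: gle.
have S1 : S 1 K by split.
have : S 1 (peval K e w psi).
  rewrite -e1; apply: peval_rel => //; first by move=> c; exact: subst_const eI.
move=> SK; rewrite eqn_leq -(Sle _ _ _ _ SK S1) -(Sle _ _ _ _ S1 SK).
by rewrite lexx.
Qed.

End Semantics.

Theorem theorem5p1 (R : realType) (V : set R) :
  goedel_set R V -> decidable_forms (fun f => BS f /\ valid_GV R V f).
Proof.
move=> HV; have [Kf cK adK] := exists_adequate HV.
have decideP f : decide Kf f <-> BS f /\ valid_GV R V f.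
  rewrite BS_decide /decide /matrix_test qfree_testE -/(matrix f).
  have herbrand : qfree (matrix f) -> valid_GV R V f <->
      tautology_test Kf (strip 6 (strip 5 f).2).1 (matrix f).
    move=> qf; rewrite {1}[f]strip_prefix (tautology_testP HV) //.
    (* The prefix carries the reversed variable list, which has the same members. *)
    by apply: valid_herbrand => // n; rewrite mem_rev.
  split=> [/and3P[qf al tt]|[[qf al] val]].
    by split=> //; rewrite herbrand.
  by apply/and3P; split=> //; rewrite -herbrand.
have [F [p pF] FE] := cmp_decide Kf cK.
exists p => f; have := pF (enc f); rewrite [F (enc f)]FE.
by rewrite -decideP; case: (decide Kf f); split.
Qed.
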